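(* Let $A \in M_{m,n}(\mathbb{R})$ and let $K_1, K_2$ be proper cones in $\mathbb{R}^n$ and $\mathbb{R}^m$, respectively. If $A \in \pi(K_1,K_2)$, then for any $B \in S(K_1,K_2)$ we have $A+B \in S(K_1,K_2)$.
   Context: $M_{m,n}(\mathbb{R})$ is the space of real $m \times n$ matrices. A set $K \subseteq \mathbb{R}^n$ is a convex cone if $K+K \subseteq K$ and $\alpha K \subseteq K$ for all $\alpha \geq 0$; a convex cone is proper if it is topologically closed, pointed ($K \cap (-K) = \{0\}$) and has nonempty interior, denoted $K^\circ$. For proper cones $K_1 \subseteq \mathbb{R}^n$ and $K_2 \subseteq \mathbb{R}^m$, $\pi(K_1,K_2)$ is the set of $A \in M_{m,n}(\mathbb{R})$ that are nonnegative, i.e. $A(K_1) \subseteq K_2$, and $S(K_1,K_2)$ is the set of $A \in M_{m,n}(\mathbb{R})$ that are semipositive, i.e. there exists $x \in K_1^\circ$ such that $Ax \in K_2^\circ$. *)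

(* Defs.v *)
From mathcomp Require Import all_boot all_order all_algebra.
From mathcomp Require Import all_classical all_reals all_analysis.
Import Order.TTheory GRing.Theory Num.Theory.
Import numFieldNormedType.Exports.
Set Implicit Arguments.
Unset Strict Implicit.
Unset Printing Implicit Defensive.

Local Open Scope classical_set_scope.
Local Open Scope ring_scope.

(* Vectors of R^n are column vectors 'cV[R]_n, with the usual (product)
   topology. *)

Definition convex_cone (R : realType) (n : nat) (K : set 'cV[R]_n) : Prop :=
  (forall x y, K x -> K y -> K (x + y)) /\
  (forall (a : R) x, 0 <= a -> K x -> K (a *: x)).

(* The empty set satisfies convex_cone, but not proper_cone. *)
Definition proper_cone (R : realType) (n : nat) (K : set 'cV[R]_n) : Prop :=
  [/\ convex_cone K,
      closed K,
      K `&` (-%R @` K) = [set 0]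
    & K° !=set0].

Definition nonnegative_mx (R : realType) (m n : nat)
    (K1 : set 'cV[R]_n) (K2 : set 'cV[R]_m) : set 'M[R]_(m, n) :=
  [set A | mulmx A @` K1 `<=` K2].

Definition semipositive_mx (R : realType) (m n : nat)
    (K1 : set 'cV[R]_n) (K2 : set 'cV[R]_m) : set 'M[R]_(m, n) :=
  [set A | exists2 x, K1° x & K2° (A *m x)].

(* Main.v *)
Require Import Defs.
From mathcomp Require Import all_boot all_order all_algebra.
From mathcomp Require Import all_classical all_reals all_analysis.
Import Order.TTheory GRing.Theory Num.Theory.
Import numFieldNormedType.Exports.
Local Open Scope classical_set_scope.
Local Open Scope ring_scope.

(** The same vector x that witnesses semipositivity of B witnesses that of
    A + B. Indeed (A + B) x = A x + B x, where A x lies in K2 because A is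
    nonnegative and x is in K1, and B x is interior to K2. A translate by an
    element of K2 maps K2 into itself, hence carries a neighbourhood of B x
    inside K2 to a neighbourhood of A x + B x inside K2. This absorption
    is [interior_addl_closed]. *)

(** Translation by - u is continuous at u + v and sends it to v, so the
    points y with y - u in K form a neighbourhood of u + v; each such y is
    u + (y - u), a sum of two elements of K. *)
Lemma interior_addl_closed (F : numFieldType) (V : pseudoMetricNormedZmodType F)
    (K : set V) (u v : V) :
  (forall x y, K x -> K y -> K (x + y)) -> K u -> K° v -> K° (u + v).
Proof.
move=> KD Ku Kv.
have cont_sub : (y - u @[y --> u + v]) --> u + v - u.
  by apply: cvgB; [exact: cvg_id | exact: cvg_cst].
have nbhsK : nbhs (u + v - u) K by rewrite addrAC subrr add0r.
rewrite /interior; near=> y.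
rewrite -(subrK u y) addrC; apply: KD => //.
near: y; exact: cont_sub.
Unshelve. all: by end_near.
Qed.

Theorem theorem2p2 (R : realType) (m n : nat) (A : 'M[R]_(m, n))
    (K1 : set 'cV[R]_n) (K2 : set 'cV[R]_m)
    (hK1 : proper_cone K1) (hK2 : proper_cone K2)
    (hA : nonnegative_mx K1 K2 A) :
  forall B : 'M[R]_(m, n),
    semipositive_mx K1 K2 B -> semipositive_mx K1 K2 (A + B).
Proof.
move=> B [x K1x K2Bx]; exists x => //.
have [[K2D _] _ _ _] := hK2.
rewrite mulmxDl; apply: interior_addl_closed => //.
by apply: hA; exists x => //; exact: interior_subset K1x.
Qed.
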